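(* For every $s=x+iy\in{\mathbb C}$ with ${\rm Re}(s)=x>\frac12$, with complex conjugate $\bar s=x-iy$, one has $$\left(1-2^{1-s}\right)\left(1-2^{1-\bar s}\right)\zeta(s)\zeta(\bar s)-\zeta(2x)=\sum_{n_1\neq n_2}\frac{(-1)^{n_1+n_2}}{n_1^{s}\,n_2^{\bar s}} ,$$ where the sum runs over pairs of positive integers $n_1\ne n_2$ and is understood as a Pringsheim-convergent double series.
   Context: $\zeta$ is the (analytically continued) Riemann zeta-function. At $s=1$ the expression $(1-2^{1-s})\zeta(s)$ is understood as its limit $\log 2$. A double series $\sum_{i,j}a_{ij}$ of complex numbers is Pringsheim-convergent with sum $S$ if for every $\varepsilon>0$ there is $\nu_\varepsilon\in{\mathbb N}$ such that for all $p,q>\nu_\varepsilon$ one has $\left|\sum_{i\le p,\,j\le q}a_{ij}-S\right|<\varepsilon$ ($p$ and $q$ independent). For a sum over $n_1\neq n_2$, the diagonal terms are taken to be $0$. *)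

(* Defs.v *)
From Stdlib Require Import Reals.
From Coquelicot Require Import Coquelicot.

Open Scope C_scope.

Definition Cexp (z : C) : C :=
  (exp (Re z) * cos (Im z), exp (Re z) * sin (Im z))%R.

(* The principal power [a ^ s]; meaningful only for [0 < a], since
   Stdlib's [ln] is [0] elsewhere. *)
Definition Rcpow (a : R) (s : C) : C := Cexp (s * RtoC (ln a)).

Definition analytic_at (f : C -> C) (z0 : C) : Prop :=
  exists (a : nat -> C) (r : R), (0 < r)%R /\
    forall z : C, (Cmod (z - z0) < r)%R ->
      is_pseries (K := C_AbsRing) (V := C_NormedModule) a (z - z0) (f z).

(* The two clauses determine [zeta] everywhere except at [1], by uniqueness
   of analytic continuation; the value at the pole is arbitrary. *)
Definition is_riemann_zeta (zeta : C -> C) : Prop :=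
  (forall s : C, (1 < Re s)%R ->
     is_series (K := C_AbsRing) (V := C_NormedModule)
       (fun n : nat => 1 / Rcpow (INR (S n)) s) (zeta s)) /\
  (forall s : C, s <> RtoC 1 -> analytic_at zeta s).

(* [(1 - 2 ^ (1 - s)) zeta(s)], replaced at [s = 1] by its limit [log 2]. *)
Definition alt_zeta (zeta : C -> C) (s : C) : C :=
  if Ceq_dec s (RtoC 1) then RtoC (ln 2)
  else (1 - Rcpow 2 (1 - s)) * zeta s.

(* Indices start at 1: [a 0 j] and [a i 0] are ignored. *)
Definition is_pringsheim_sum (a : nat -> nat -> C) (S : C) : Prop :=
  forall eps : R, (0 < eps)%R ->
    exists nu : nat, forall p q : nat, (nu < p)%nat -> (nu < q)%nat ->
      (Cmod (sum_n_m (fun i : nat => sum_n_m (fun j : nat => a i j) 1 q) 1 p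
             - S) < eps)%R.

(* Main.v *)
Require Import Defs.
From Stdlib Require Import Reals Lra Lia.
From Coquelicot Require Import Coquelicot.

(** Put [eta s = sum_(n >= 1) (-1)^(n-1) n^(-s)], convergent for [Re s > 0].
A rectangular partial sum of the off-diagonal series is the product of a
partial sum at [s] and one at the conjugate of [s], minus the diagonal
[sum_(n <= min p q) n^(-2x)] ([off_diagonal_sum]).  The signs square away on
the diagonal, and [2x > 1], so the diagonal tends to [zeta (2x)], while the
product tends to [eta s * eta (Cconj s)].  Everything thus rests on
[eta s = (1 - 2^(1-s)) zeta s] for [Re s > 0] ([eta_alt_zeta]).

For [Re s > 1] this is the rearrangement
[sum_(n <= 2N) (-1)^n n^(-s) = 2^(1-s) sum_(n <= N) n^(-s) - sum_(n <= 2N) n^(-s)].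
It is carried to [Re s > 0] without complex function theory, by moving along
lines on which both sides are pairs of functions of one real variable.
- On a horizontal line [Im s = y] with [y <> 0], which avoids the pole, both
  sides are real-analytic in [x > 0] and agree for [x > 1], so they agree by the
  one-variable identity theorem ([real_analytic_identity]).
- At a real point other than [1], both sides are limits of their values at
  nearby non-real points of the same vertical line.
- At [1] the rearrangement reads [H_N - H_(2N)], which tends to [- ln 2] because
  [H_n - ln n] converges.

The analyticity of [eta] is the one analytic estimate.  Grouping terms in
pairs [(2n+1)^(-s) - (2n+2)^(-s)] makes the series absolutely convergent, with
terms dominated by a telescoping series ([ex_series_gap]).  The same domination
holds, uniformly in the degree, for the Taylor polynomials of the pairs in [x]
([taylor_coef_diff_bound]), so dominated convergence ([is_lim_seq_dominated])
allows the sum over [n] and the Taylor sum to be exchanged. *)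

Open Scope R_scope.

(** * Dominated convergence for series *)

Lemma sum_n_S (a : nat -> R) (N : nat) : sum_n a (S N) = sum_n a N + a (S N).
Proof. exact (sum_Sn a N). Qed.

Lemma scal_pow_n (x a : R) (k : nat) :
  scal (K := R_AbsRing) (V := R_NormedModule) (pow_n (K := R_AbsRing) x k) a
  = x ^ k * a.
Proof. exact (f_equal (fun z => z * a) (pow_n_pow x k)). Qed.

Lemma ex_series_Rmult (c : R) (a : nat -> R) :
  ex_series a -> ex_series (fun n => c * a n).
Proof. intros [l H]. exists (c * l). exact (is_series_scal_l c a l H). Qed.

Lemma sum_n_le_Series (a : nat -> R) (l : R) (N : nat) :
  (forall n, 0 <= a n) -> is_series a l -> sum_n a N <= l.
Proof.
  intros Ha Hl.
  apply (is_lim_seq_incr_compare (sum_n a) l Hl).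
  intros n. rewrite sum_n_S. specialize (Ha (S n)). lra.
Qed.

Lemma is_lim_seq_sum_n (u : nat -> nat -> R) (l : nat -> R) (N : nat) :
  (forall n, is_lim_seq (fun k => u k n) (l n)) ->
  is_lim_seq (fun k => sum_n (u k) N) (sum_n l N).
Proof.
  intros Hu. induction N as [|N IH].
  - rewrite sum_O. apply is_lim_seq_ext with (2 := Hu 0%nat).
    intros k. now rewrite sum_O.
  - rewrite sum_n_S.
    apply is_lim_seq_ext with (fun k => sum_n (u k) N + u k (S N)).
    + intros k. now rewrite sum_n_S.
    + now apply is_lim_seq_plus'.
Qed.

(** Dominated convergence for the counting measure (Tannery's theorem).  The tail
of [|u k n - l n|] beyond [N] is at most twice the tail of [v], whatever [k] is,
and the head is a finite sum that tends to [0]. *)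
Lemma is_lim_seq_dominated (u : nat -> nat -> R) (v l : nat -> R) :
  ex_series v ->
  (forall k n, Rabs (u k n) <= v n) ->
  (forall n, is_lim_seq (fun k => u k n) (l n)) ->
  ex_series l /\ is_lim_seq (fun k => Series (u k)) (Series l).
Proof.
  intros [V HV] Huv Hul.
  assert (Hlv : forall n, Rabs (l n) <= v n).
  { intros n.
    apply (is_lim_seq_le (fun k => Rabs (u k n)) (fun _ => v n)
             (Rabs (l n)) (v n)).
    - intros k. apply Huv.
    - apply (is_lim_seq_abs _ (l n)), Hul.
    - apply is_lim_seq_const. }
  assert (Hu : forall k, ex_series (u k)).
  { intros k. apply (@ex_series_le R_AbsRing R_CompleteNormedModule) with v.
    - apply Huv.
    - now exists V. }
  assert (Hl : ex_series l).
  { apply (@ex_series_le R_AbsRing R_CompleteNormedModule) with v.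
    - apply Hlv.
    - now exists V. }
  split; [exact Hl|].
  (* [2 v - w k] has nonnegative terms, so its partial sums are below its sum:
     that is the bound on the tails of [w k]. *)
  set (w := fun k n => Rabs (u k n - l n)).
  assert (Hw2 : forall k n, 0 <= w k n <= 2 * v n).
  { intros k n. unfold w. split; [apply Rabs_pos|].
    generalize (Rabs_triang (u k n) (- l n)). rewrite Rabs_Ropp.
    specialize (Huv k n). specialize (Hlv n). unfold Rminus. lra. }
  assert (H2V : is_series (fun n => 2 * v n) (2 * V)).
  { apply (is_series_scal_l 2 v V HV). }
  assert (Hw : forall k, ex_series (w k)).
  { intros k.
    apply (@ex_series_le R_AbsRing R_CompleteNormedModule)
      with (fun n => 2 * v n).
    - intros n. unfold norm; simpl; unfold abs; simpl.
      rewrite Rabs_pos_eq; apply Hw2.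
    - now exists (2 * V). }
  assert (Hdist : forall k, Rabs (Series (u k) - Series l) <= Series (w k)).
  { intros k. rewrite <- Series_minus by auto.
    apply (Series_Rabs (fun n => u k n - l n)). apply (Hw k). }
  assert (Hsplit : forall k N,
             Series (w k) <= sum_n (w k) N + (2 * V - sum_n (fun n => 2 * v n) N)).
  { intros k N.
    assert (H : is_series (fun n => 2 * v n - w k n) (2 * V - Series (w k))).
    { apply (is_series_minus (fun n => 2 * v n) (w k)).
      - exact H2V.
      - apply Series_correct, Hw. }
    apply (sum_n_le_Series _ _ N) in H.
    - assert (E : sum_n (fun n => 2 * v n - w k n) N
                  = sum_n (fun n => 2 * v n) N - sum_n (w k) N).
      { clear. induction N as [|N IH].
        - now rewrite !sum_O.
        - rewrite !sum_n_S, IH. simpl. ring. }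
      rewrite E in H. lra.
    - intros n. specialize (Hw2 k n). lra. }
  apply is_lim_seq_spec. intros eps.
  assert (He : 0 < eps / 2) by (generalize (cond_pos eps); lra).
  assert (HV' : is_lim_seq (sum_n (fun n => 2 * v n)) (2 * V)) by exact H2V.
  apply is_lim_seq_spec in HV'. destruct (HV' (mkposreal _ He)) as [N HN].
  specialize (HN N (le_n N)). simpl in HN.
  assert (Hfin : is_lim_seq (fun k => sum_n (w k) N) (sum_n (fun _ => 0) N)).
  { apply (is_lim_seq_sum_n w (fun _ => 0)). intros n. unfold w.
    rewrite <- Rabs_R0. apply (is_lim_seq_abs _ 0).
    replace (Finite 0) with (Finite (l n - l n)) by (f_equal; ring).
    apply is_lim_seq_minus'; [apply Hul | apply is_lim_seq_const]. }
  apply is_lim_seq_spec in Hfin. destruct (Hfin (mkposreal _ He)) as [K HK].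
  exists K. intros k Hk. specialize (HK k Hk). simpl in HK.
  assert (Z : sum_n (fun _ => 0) N = 0).
  { rewrite sum_n_const. apply Rmult_0_r. }
  rewrite Z in HK.
  apply Rabs_def2 in HN. apply Rabs_def2 in HK.
  apply Rle_lt_trans with (1 := Hdist k).
  specialize (Hsplit k N). lra.
Qed.

(** * Real-analytic functions of one real variable *)

Definition real_analytic_at (f : R -> R) (x0 : R) : Prop :=
  exists (a : nat -> R) (r : R), 0 < r /\
    forall x, Rabs (x - x0) < r -> is_pseries a (x - x0) (f x).

(** Convergence on a whole disc puts each point of the disc strictly inside the
disc of convergence, as required for continuity and for products. *)
Lemma CV_radius_gt (a : nat -> R) (f : R -> R) (x0 r x : R) :
  (forall x, Rabs (x - x0) < r -> is_pseries a (x - x0) (f x)) ->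
  Rabs (x - x0) < r -> Rbar_lt (Rabs (x - x0)) (CV_radius a).
Proof.
  intros Ha Hx. set (h := (Rabs (x - x0) + r) / 2).
  assert (Hh : Rabs (x - x0) < h < r) by (unfold h; lra).
  assert (Hh0 : 0 <= h) by (generalize (Rabs_pos (x - x0)); lra).
  apply Rbar_lt_le_trans with (Finite h); [simpl; lra|].
  destruct (Rbar_le_lt_dec h (CV_radius a)) as [H|H]; [exact H|exfalso].
  rewrite <- (Rabs_pos_eq h Hh0) in H.
  apply (CV_disk_outside a h H).
  assert (E : is_pseries a h (f (x0 + h))).
  { replace h with (x0 + h - x0) at 1 by ring. apply Ha.
    replace (x0 + h - x0) with h by ring. rewrite Rabs_pos_eq; lra. }
  apply ex_series_lim_0. exists (f (x0 + h)).
  apply is_series_ext with (2 := E).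
  intros n. rewrite pow_n_pow. unfold scal; simpl; unfold mult; simpl. ring.
Qed.

Lemma real_analytic_ext (f g : R -> R) (x0 : R) :
  (forall x, f x = g x) -> real_analytic_at f x0 -> real_analytic_at g x0.
Proof.
  intros E (a & r & Hr & H). exists a, r. split; [exact Hr|].
  intros x Hx. rewrite <- E. now apply H.
Qed.

Lemma real_analytic_plus (f g : R -> R) (x0 : R) :
  real_analytic_at f x0 -> real_analytic_at g x0 ->
  real_analytic_at (fun x => f x + g x) x0.
Proof.
  intros (a & r & Hr & Ha) (b & t & Ht & Hb).
  exists (PS_plus a b), (Rmin r t). split; [now apply Rmin_glb_lt|].
  intros x Hx.
  apply (is_pseries_plus a b).
  - apply Ha. eapply Rlt_le_trans; [exact Hx | apply Rmin_l].
  - apply Hb. eapply Rlt_le_trans; [exact Hx | apply Rmin_r].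
Qed.

Lemma real_analytic_mult (f g : R -> R) (x0 : R) :
  real_analytic_at f x0 -> real_analytic_at g x0 ->
  real_analytic_at (fun x => f x * g x) x0.
Proof.
  intros (a & r & Hr & Ha) (b & t & Ht & Hb).
  exists (PS_mult a b), (Rmin r t). split; [now apply Rmin_glb_lt|].
  intros x Hx.
  assert (Hxr : Rabs (x - x0) < r)
    by (eapply Rlt_le_trans; [exact Hx | apply Rmin_l]).
  assert (Hxt : Rabs (x - x0) < t)
    by (eapply Rlt_le_trans; [exact Hx | apply Rmin_r]).
  apply is_pseries_mult.
  - now apply Ha.
  - now apply Hb.
  - now apply (CV_radius_gt a f x0 r).
  - now apply (CV_radius_gt b g x0 t).
Qed.

Lemma real_analytic_const (c x0 : R) : real_analytic_at (fun _ => c) x0.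
Proof.
  exists (fun n => match n with 0%nat => c | _ => 0 end), 1.
  split; [lra|]. intros x _.
  apply (is_lim_seq_ext (fun _ => c) _ c); [|apply is_lim_seq_const].
  intros n. induction n as [|n IH].
  - rewrite sum_O. simpl. now rewrite scal_one.
  - rewrite sum_Sn, <- IH.
    unfold plus, scal; simpl; unfold mult; simpl. ring.
Qed.

Lemma real_analytic_exp (m c x0 : R) :
  real_analytic_at (fun x => exp (c - x * m)) x0.
Proof.
  exists (fun n => exp (c - x0 * m) * ((- m) ^ n * / INR (Factorial.fact n))), 1.
  split; [lra|]. intros x _.
  assert (H := is_exp_Reals (- m * (x - x0))).
  replace (exp (c - x * m)) with (exp (c - x0 * m) * exp (- m * (x - x0)))
    by (rewrite <- exp_plus; f_equal; ring).
  apply (is_series_scal_l (exp (c - x0 * m))) in H.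
  apply is_series_ext with (2 := H). intros n.
  rewrite (pow_n_pow (- m * (x - x0))), (pow_n_pow (x - x0)), Rpow_mult_distr.
  unfold scal; simpl; unfold mult; simpl. ring.
Qed.

Lemma real_analytic_continuous (f : R -> R) (x0 : R) :
  real_analytic_at f x0 -> continuous f x0.
Proof.
  intros (a & r & Hr & Ha).
  assert (H0 : Rabs (x0 - x0) < r)
    by (replace (x0 - x0) with 0 by ring; rewrite Rabs_R0; lra).
  apply (continuous_ext_loc _ (fun x => PSeries a (x - x0))).
  - exists (mkposreal r Hr). intros x Hx.
    apply is_pseries_unique, Ha, Hx.
  - apply (continuous_comp (fun x => x - x0) (PSeries a)).
    + apply (continuous_minus (fun x => x) (fun _ => x0)).
      * apply continuous_id.
      * apply continuous_const.
    + apply continuity_pt_filterlim, PSeries_continuity.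
      now apply (CV_radius_gt a f x0 r).
Qed.

(** Cancel the constant term and divide by [x]: one-sided vanishing suffices,
    because the value at the centre is already the one-sided limit. *)
Lemma pseries_zero_right (n : nat) : forall (a : nat -> R) (r : R), 0 < r ->
  Rbar_le r (CV_radius a) ->
  (forall x, 0 < x < r -> PSeries a x = 0) -> a n = 0.
Proof.
  assert (H0 : forall (a : nat -> R) (r : R), 0 < r ->
             Rbar_le r (CV_radius a) ->
             (forall x, 0 < x < r -> PSeries a x = 0) -> a 0%nat = 0).
  { intros a r Hr HR Hz.
    assert (HC : continuous (PSeries a) 0).
    { apply continuity_pt_filterlim, PSeries_continuity.
      rewrite Rabs_R0. apply Rbar_lt_le_trans with (2 := HR). exact Hr. }
    rewrite <- PSeries_0.
    assert (L1 : is_lim_seq (fun k => PSeries a (r / (INR k + 2))) (PSeries a 0)).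
    { apply (filterlim_comp _ _ _ (fun k => r / (INR k + 2)) (PSeries a)
               eventually (locally 0)); [|exact HC].
      change (is_lim_seq (fun k => r / (INR k + 2)) 0).
      replace (Finite 0) with (Rbar_mult r 0) by (simpl; f_equal; ring).
      apply is_lim_seq_scal_l.
      replace (Finite 0) with (Rbar_inv p_infty) by reflexivity.
      apply is_lim_seq_inv; [|discriminate].
      eapply is_lim_seq_plus;
        [apply is_lim_seq_INR | apply is_lim_seq_const | reflexivity]. }
    assert (L2 : is_lim_seq (fun k => PSeries a (r / (INR k + 2))) 0).
    { apply is_lim_seq_ext with (fun _ => 0); [|apply is_lim_seq_const].
      intros k. symmetry. apply Hz. generalize (pos_INR k). intros Hk. split.
      - apply Rdiv_lt_0_compat; lra.
      - apply (Rmult_lt_reg_r (INR k + 2)); [lra|].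
        unfold Rdiv. rewrite Rmult_assoc, Rinv_l by lra. nra. }
    apply is_lim_seq_unique in L1. apply is_lim_seq_unique in L2.
    rewrite L1 in L2. now injection L2. }
  induction n as [|n IH]; [exact H0|].
  intros a r Hr HR Hz.
  apply (IH (PS_decr_1 a) r Hr).
  - now rewrite CV_radius_decr_1.
  - intros x Hx.
    assert (E : ex_pseries a x).
    { apply CV_radius_inside. apply Rbar_lt_le_trans with (2 := HR).
      simpl. rewrite Rabs_pos_eq; lra. }
    apply PSeries_decr_1 in E. rewrite Hz, (H0 a r) in E by auto.
    apply (Rmult_eq_reg_l x); lra.
Qed.

(** The points where [f] does not vanish are bounded; at their supremum the
    power series of [f] vanishes to the right, hence identically, hence [f]
    vanishes slightly to the left of it as well. *)
Lemma real_analytic_identity (f : R -> R) (A B : R) :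
  (forall x, A < x -> real_analytic_at f x) ->
  (forall x, B < x -> f x = 0) ->
  forall x, A < x -> f x = 0.
Proof.
  intros Hf Hz x1 Hx1. destruct (Req_dec (f x1) 0) as [E|E]; [exact E|exfalso].
  destruct (completeness (fun x => A < x /\ f x <> 0)) as [m [Hub Hlub]].
  { exists B. intros x [_ Hx]. destruct (Rle_dec x B) as [H|H]; [exact H|].
    exfalso. apply Hx, Hz. lra. }
  { exists x1. split; assumption. }
  assert (Hm : x1 <= m) by (apply Hub; now split).
  assert (Hr0 : forall x, m < x -> f x = 0).
  { intros x Hx. destruct (Req_dec (f x) 0) as [H|H]; [exact H|exfalso].
    assert (x <= m) by (apply Hub; split; [lra | exact H]). lra. }
  destruct (Hf m) as (a & r & Hr & Ha); [lra|].
  assert (HR : Rbar_le (r / 2) (CV_radius a)).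
  { replace (r / 2) with (Rabs (m + r / 2 - m)).
    - apply Rbar_lt_le, (CV_radius_gt a f m r); [exact Ha|].
      replace (m + r / 2 - m) with (r / 2) by ring. rewrite Rabs_pos_eq; lra.
    - replace (m + r / 2 - m) with (r / 2) by ring. rewrite Rabs_pos_eq; lra. }
  assert (Ha0 : forall n, a n = 0).
  { intros n. apply (pseries_zero_right n a (r / 2)); [lra | exact HR |].
    intros x Hx. apply is_pseries_unique.
    rewrite <- (Hr0 (m + x)) by lra.
    replace x with (m + x - m) at 1 by ring. apply Ha.
    replace (m + x - m) with x by ring. rewrite Rabs_pos_eq; lra. }
  assert (Hb : m <= m - r / 2); [|lra].
  apply Hlub. intros x [HAx Hx].
  destruct (Rle_dec x (m - r / 2)) as [H|H]; [exact H|exfalso].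
  destruct (Rle_dec x m) as [H'|H']; [|apply Hx, Hr0; lra].
  apply Hx.
  assert (P : is_pseries a (x - m) (f x)) by (apply Ha, Rabs_def1; lra).
  apply is_pseries_unique in P. rewrite <- P.
  rewrite (PSeries_ext a (fun _ => 0)) by exact Ha0.
  apply PSeries_const_0.
Qed.

(** * The paired alternating Dirichlet series *)

(** With [s = x + i y] and [t = ln n], the real and imaginary parts of [n^(-s)]
are [osc x y 0 t] and [osc x y (PI / 2) t] ([Cinv_Rcpow]); the phase [phi] lets
one argument treat both. *)
Definition osc (x y phi t : R) : R := exp (- (x * t)) * cos (y * t + phi).

Lemma exp_le_compat (u v : R) : u <= v -> exp u <= exp v.
Proof.
  intros [H|H]; [left; now apply exp_increasing | rewrite H; apply Rle_refl].
Qed.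

Lemma osc_bound (x y phi t : R) : Rabs (osc x y phi t) <= exp (- (x * t)).
Proof.
  unfold osc. rewrite Rabs_mult.
  rewrite (Rabs_pos_eq (exp _)) by (left; apply exp_pos).
  assert (Rabs (cos (y * t + phi)) <= 1) by (apply Rabs_le, COS_bound).
  generalize (exp_pos (- (x * t))). nra.
Qed.

Lemma osc_lipschitz (x y phi a b : R) : 0 <= x -> a <= b ->
  Rabs (osc x y phi a - osc x y phi b)
  <= (x + Rabs y) * (b - a) * exp (- (x * a)).
Proof.
  intros Hx [Hab|Hab].
  2: { rewrite Hab. replace (osc x y phi b - osc x y phi b) with 0 by ring.
       rewrite Rabs_R0. lra. }
  destruct (MVT_cor2 (osc x y phi)
              (fun t => exp (- (x * t)) * (- x * cos (y * t + phi)
                                           - y * sin (y * t + phi))) a b Hab)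
    as (c & Hc & Hac).
  { intros c _. apply is_derive_Reals. unfold osc. auto_derive; [easy|]. ring. }
  rewrite <- Rabs_Ropp, Ropp_minus_distr, Hc, !Rabs_mult.
  rewrite (Rabs_pos_eq (b - a)) by lra.
  rewrite (Rabs_pos_eq (exp _)) by (left; apply exp_pos).
  assert (H1 : exp (- (x * c)) <= exp (- (x * a))).
  { apply exp_le_compat. nra. }
  assert (H2 : Rabs (- x * cos (y * c + phi) - y * sin (y * c + phi))
               <= x + Rabs y).
  { eapply Rle_trans; [apply Rabs_triang|].
    rewrite Rabs_Ropp, !Rabs_mult, Rabs_Ropp, (Rabs_pos_eq x) by exact Hx.
    assert (Rabs (cos (y * c + phi)) <= 1) by (apply Rabs_le, COS_bound).
    assert (Rabs (sin (y * c + phi)) <= 1) by (apply Rabs_le, SIN_bound).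
    generalize (Rabs_pos y). nra. }
  generalize (exp_pos (- (x * c))) (Rabs_pos y)
    (Rabs_pos (- x * cos (y * c + phi) - y * sin (y * c + phi))). intros.
  replace ((x + Rabs y) * (b - a) * exp (- (x * a)))
    with (exp (- (x * a)) * (x + Rabs y) * (b - a)) by ring.
  apply Rmult_le_compat_r; [lra|]. apply Rmult_le_compat; lra.
Qed.

Lemma exp_diff_le (u v : R) : exp v - exp u <= (v - u) * exp v.
Proof.
  generalize (exp_ineq1_le (u - v)) (exp_pos v). intros H Hv.
  replace (exp u) with (exp v * exp (u - v))
    by (rewrite <- exp_plus; f_equal; ring). nra.
Qed.

(** Taylor coefficients in [x], at fixed [t]: shifting [x] by [h] multiplies [osc]
by [exp (- h t)]. *)
Definition taylor_coef (x y phi t : R) (k : nat) : R :=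
  osc x y phi t * ((- t) ^ k * / INR (Factorial.fact k)).

Lemma taylor_osc (x y phi t h : R) :
  is_series (fun k => h ^ k * taylor_coef x y phi t k) (osc (x + h) y phi t).
Proof.
  assert (H := is_exp_Reals (h * - t)).
  apply (is_series_scal_l (osc x y phi t)) in H.
  replace (osc (x + h) y phi t) with (osc x y phi t * exp (h * - t)).
  - apply is_series_ext with (2 := H). intros k.
    rewrite pow_n_pow, Rpow_mult_distr. unfold taylor_coef, scal; simpl.
    unfold mult; simpl. ring.
  - unfold osc. replace (- ((x + h) * t)) with (- (x * t) + h * - t) by ring.
    rewrite exp_plus. ring.
Qed.

Lemma exp_series (u : R) :
  is_series (fun k => u ^ k * / INR (Factorial.fact k)) (exp u).
Proof.
  apply is_series_ext with (2 := is_exp_Reals u). intros k.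
  now rewrite pow_n_pow.
Qed.

Lemma sum_n_exp_le (u : R) (K : nat) : 0 <= u ->
  sum_n (fun k => u ^ k * / INR (Factorial.fact k)) K <= exp u.
Proof.
  intros Hu. apply sum_n_le_Series.
  - intros k. apply Rmult_le_pos; [now apply pow_le|].
    left. apply Rinv_0_lt_compat, INR_fact_lt_0.
  - apply exp_series.
Qed.

Lemma sum_n_exp_diff_le (u v : R) (K : nat) : 0 <= u <= v ->
  sum_n (fun k => v ^ k * / INR (Factorial.fact k)
                  - u ^ k * / INR (Factorial.fact k)) K <= exp v - exp u.
Proof.
  intros Hu. apply sum_n_le_Series.
  - intros k. apply Rge_le, Rge_minus, Rle_ge, Rmult_le_compat_r.
    + left. apply Rinv_0_lt_compat, INR_fact_lt_0.
    + now apply pow_incr.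
  - apply (is_series_minus (fun k => v ^ k * / INR (Factorial.fact k))
             (fun k => u ^ k * / INR (Factorial.fact k))); apply exp_series.
Qed.

(** With [p], [q] the values of [osc] at [a], [b], the [k]-th difference is, up to
sign, [((p - q) a^k + q (a^k - b^k)) / k!].  Weighted by [rho^k] and summed, this
gives [|p - q| exp (rho a) + |q| (exp (rho b) - exp (rho a))].  Both terms carry a
factor [b - a], and as [rho <= x] the exponentials that remain are at most
[exp (- (x - rho) a)]. *)
Lemma taylor_coef_diff_bound (x y phi rho a b : R) (K : nat) :
  0 <= a <= b -> 0 <= rho <= x ->
  sum_n (fun k => rho ^ k * Rabs (taylor_coef x y phi a k
                                  - taylor_coef x y phi b k)) K
  <= (x + Rabs y + rho) * ((b - a) * exp (- ((x - rho) * a))).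
Proof.
  intros Hab Hrho.
  set (p := osc x y phi a). set (q := osc x y phi b).
  set (e := fun u k => u ^ k * / INR (Factorial.fact k)).
  apply Rle_trans with
    (Rabs (p - q) * exp (rho * a) + Rabs q * (exp (rho * b) - exp (rho * a))).
  - apply Rle_trans with
      (Rabs (p - q) * sum_n (e (rho * a)) K
       + Rabs q * sum_n (fun k => e (rho * b) k - e (rho * a) k) K).
    + assert (G : forall k, rho ^ k * Rabs (taylor_coef x y phi a k
                                            - taylor_coef x y phi b k)
                  <= Rabs (p - q) * e (rho * a) k
                     + Rabs q * (e (rho * b) k - e (rho * a) k)).
      { intros k. unfold taylor_coef, e. fold p q.
        assert (Hf : 0 < / INR (Factorial.fact k))
          by apply Rinv_0_lt_compat, INR_fact_lt_0.
        set (f := / INR (Factorial.fact k)) in *.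
        replace (p * ((- a) ^ k * f) - q * ((- b) ^ k * f))
          with ((-1) ^ k * (f * ((p - q) * a ^ k + q * - (b ^ k - a ^ k)))).
        2: { replace (- a) with (-1 * a) by ring.
             replace (- b) with (-1 * b) by ring.
             rewrite !Rpow_mult_distr. ring. }
        rewrite Rabs_mult, pow_1_abs, Rmult_1_l, Rabs_mult.
        rewrite (Rabs_pos_eq f) by lra.
        assert (Hk : a ^ k <= b ^ k) by now apply pow_incr.
        assert (Ha : 0 <= a ^ k) by now apply pow_le.
        assert (Hr : 0 <= rho ^ k) by now apply pow_le.
        rewrite !Rpow_mult_distr.
        assert (Ht := Rabs_triang ((p - q) * a ^ k) (q * - (b ^ k - a ^ k))).
        rewrite !Rabs_mult, Rabs_Ropp in Ht.
        rewrite (Rabs_pos_eq (a ^ k)), (Rabs_pos_eq (b ^ k - a ^ k)) in Ht by lra.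
        replace (Rabs (p - q) * (rho ^ k * a ^ k * f)
                 + Rabs q * (rho ^ k * b ^ k * f - rho ^ k * a ^ k * f))
          with (rho ^ k * (f * (Rabs (p - q) * a ^ k
                                + Rabs q * (b ^ k - a ^ k)))) by ring.
        apply Rmult_le_compat_l; [exact Hr|].
        apply Rmult_le_compat_l; lra. }
      clear - G. induction K as [|K IH].
      * rewrite !sum_O. apply G.
      * rewrite !sum_n_S. specialize (G (S K)). lra.
    + apply Rplus_le_compat; apply Rmult_le_compat_l; try apply Rabs_pos.
      * apply sum_n_exp_le. nra.
      * apply sum_n_exp_diff_le. nra.
  - assert (H1 := osc_lipschitz x y phi a b ltac:(lra) ltac:(lra)).
    fold p q in H1.
    assert (H2 : Rabs q <= exp (- (x * b))) by apply osc_bound.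
    assert (H3 := exp_diff_le (rho * a) (rho * b)).
    assert (H4 : exp (- (x * b)) * exp (rho * b) <= exp (- ((x - rho) * a))).
    { rewrite <- exp_plus. apply exp_le_compat. nra. }
    assert (H5 : exp (- (x * a)) * exp (rho * a) = exp (- ((x - rho) * a))).
    { rewrite <- exp_plus. f_equal. ring. }
    generalize (exp_pos (rho * a)) (exp_pos (rho * b)) (exp_pos (- (x * b)))
      (Rabs_pos q) (Rabs_pos (p - q)) (Rabs_pos y). intros.
    assert (Rabs (p - q) * exp (rho * a)
            <= (x + Rabs y) * (b - a) * exp (- ((x - rho) * a))).
    { rewrite <- H5, <- Rmult_assoc. apply Rmult_le_compat_r; lra. }
    assert (Rabs q * (exp (rho * b) - exp (rho * a))
            <= rho * (b - a) * exp (- ((x - rho) * a))).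
    { apply Rle_trans with (exp (- (x * b)) * (rho * (b - a) * exp (rho * b))).
      - apply Rmult_le_compat; try lra.
        assert (exp (rho * a) <= exp (rho * b)) by (apply exp_le_compat; nra).
        lra.
      - replace (exp (- (x * b)) * (rho * (b - a) * exp (rho * b)))
          with (rho * (b - a) * (exp (- (x * b)) * exp (rho * b))) by ring.
        apply Rmult_le_compat_l; [nra | exact H4]. }
    lra.
Qed.

Definition ln_odd (n : nat) : R := ln (INR (2 * n + 1)).
Definition ln_even (n : nat) : R := ln (INR (2 * n + 2)).

Lemma ln_INR_le (m n : nat) : (0 < m <= n)%nat -> ln (INR m) <= ln (INR n).
Proof. intros H. apply ln_le; [apply lt_0_INR | apply le_INR]; lia. Qed.

Lemma ln_odd_ge_0 (n : nat) : 0 <= ln_odd n.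
Proof. rewrite <- ln_1. apply (ln_INR_le 1). lia. Qed.

Lemma ln_odd_even (n : nat) : ln_odd n <= ln_even n.
Proof. apply ln_INR_le. lia. Qed.

Lemma ln_even_odd (n : nat) : ln_even n <= ln_odd (S n).
Proof. apply ln_INR_le. lia. Qed.

Lemma ln_odd_step (n : nat) : ln_odd (S n) <= ln_odd n + ln 3.
Proof.
  unfold ln_odd. rewrite <- ln_mult; [|apply lt_0_INR; lia|lra].
  replace 3 with (INR 3) by (simpl; ring). rewrite <- mult_INR.
  apply ln_INR_le. lia.
Qed.

(** Up to the constant [3 ^ tau / tau], the terms are dominated by those of
    the telescoping series [exp (- tau ln (2 n + 1)) - exp (- tau ln (2 n + 3))]. *)
Lemma ex_series_gap (tau : R) : 0 < tau ->
  ex_series (fun n => (ln_even n - ln_odd n) * exp (- (tau * ln_odd n))).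
Proof.
  intros Ht. set (w := fun n => _).
  set (C := exp (tau * ln 3) / tau).
  assert (HC : 0 < C) by (apply Rdiv_lt_0_compat; [apply exp_pos | lra]).
  set (g := fun n => exp (- (tau * ln_odd n))).
  assert (Hw0 : forall n, 0 <= w n).
  { intros n. unfold w. apply Rmult_le_pos; [|left; apply exp_pos].
    generalize (ln_odd_even n). lra. }
  assert (Hw : forall n, w n <= C * (g n - g (S n))).
  { intros n. unfold w, g, C.
    generalize (ln_odd_even n) (ln_even_odd n) (ln_odd_step n). intros H1 H2 H3.
    set (u := ln_odd (S n) - ln_odd n) in *.
    replace (- (tau * ln_odd (S n))) with (- (tau * ln_odd n) + - (tau * u))
      by (unfold u; ring).
    rewrite exp_plus.
    assert (H4 : tau * u <= exp (tau * ln 3) * (1 - exp (- (tau * u)))).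
    { apply Rle_trans with (exp (tau * u) * (1 - exp (- (tau * u)))).
      - rewrite Rmult_minus_distr_l, <- exp_plus.
        replace (tau * u + - (tau * u)) with 0 by ring. rewrite exp_0.
        generalize (exp_ineq1_le (tau * u)). lra.
      - apply Rmult_le_compat_r.
        + assert (exp (- (tau * u)) <= exp 0)
            by (apply exp_le_compat; unfold u; nra).
          rewrite exp_0 in *. lra.
        + apply exp_le_compat, Rmult_le_compat_l; unfold u; lra. }
    generalize (exp_pos (- (tau * ln_odd n))). set (E := exp _). intros HE.
    replace (exp (tau * ln 3) / tau * (E - E * exp (- (tau * u))))
      with (exp (tau * ln 3) * (1 - exp (- (tau * u))) / tau * E)
      by (field; lra).
    apply Rmult_le_compat_r; [lra|].
    apply (Rmult_le_reg_r tau); [lra|]. unfold Rdiv.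
    rewrite Rmult_assoc, Rinv_l by lra. unfold u in *. nra. }
  assert (Hsum : forall N, sum_n w N <= C * (g 0%nat - g (S N))).
  { induction N as [|N IH].
    - rewrite sum_O. apply Hw.
    - rewrite sum_n_S. specialize (Hw (S N)). lra. }
  destruct (ex_finite_lim_seq_incr (sum_n w) (C * g 0%nat)) as [l Hl].
  - intros N. rewrite sum_n_S. specialize (Hw0 (S N)). lra.
  - intros N. apply Rle_trans with (1 := Hsum N).
    apply Rmult_le_compat_l; [lra|].
    assert (0 < g (S N)) by apply exp_pos. lra.
  - exists l. exact Hl.
Qed.

Definition pair_term (x y phi : R) (n : nat) : R :=
  osc x y phi (ln_odd n) - osc x y phi (ln_even n).

Definition eta_part (phi x y : R) : R := Series (pair_term x y phi).

Lemma pair_term_bound (x y phi : R) (n : nat) : 0 <= x ->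
  Rabs (pair_term x y phi n)
  <= (x + Rabs y) * ((ln_even n - ln_odd n) * exp (- (x * ln_odd n))).
Proof.
  intros Hx. rewrite <- Rmult_assoc.
  apply osc_lipschitz; [exact Hx | apply ln_odd_even].
Qed.

Lemma is_series_eta_part (phi x y : R) : 0 < x ->
  is_series (pair_term x y phi) (eta_part phi x y).
Proof.
  intros Hx. apply Series_correct.
  apply (@ex_series_le R_AbsRing R_CompleteNormedModule) with
    (fun n => (x + Rabs y)
              * ((ln_even n - ln_odd n) * exp (- (x * ln_odd n)))).
  - intros n. apply pair_term_bound. lra.
  - now apply ex_series_Rmult, ex_series_gap.
Qed.

Lemma eta_part_continuous (phi x y M : R) (u : nat -> R) : 0 < x ->
  (forall k, Rabs (u k) <= M) -> is_lim_seq u y ->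
  is_lim_seq (fun k => eta_part phi x (u k)) (eta_part phi x y).
Proof.
  intros Hx HM Hu.
  apply (is_lim_seq_dominated (fun k => pair_term x (u k) phi)
    (fun n => (x + M) * ((ln_even n - ln_odd n) * exp (- (x * ln_odd n))))).
  - now apply ex_series_Rmult, ex_series_gap.
  - intros k n. apply Rle_trans with (1 := pair_term_bound x (u k) phi n ltac:(lra)).
    apply Rmult_le_compat_r; [|specialize (HM k); lra].
    apply Rmult_le_pos; [|left; apply exp_pos].
    generalize (ln_odd_even n). lra.
  - assert (G : forall t, is_lim_seq (fun k => osc x (u k) phi t) (osc x y phi t)).
    { intros t. unfold osc. apply (is_lim_seq_scal_l _ _ (cos (y * t + phi))).
      apply (is_lim_seq_continuous cos (fun k => u k * t + phi)).
      - apply continuity_cos.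
      - apply is_lim_seq_plus'; [|apply is_lim_seq_const].
        now apply (is_lim_seq_scal_r u t y). }
    intros n. now apply is_lim_seq_minus'.
Qed.

Lemma sum_n_Series (c : nat -> nat -> R) (h : R) (K : nat) :
  (forall k, ex_series (c k)) ->
  is_series (fun n => sum_n (fun k => h ^ k * c k n) K)
            (sum_n (fun k => h ^ k * Series (c k)) K).
Proof.
  intros Hc.
  assert (G : forall k, is_series (fun n => h ^ k * c k n) (h ^ k * Series (c k))).
  { intros k. apply (is_series_scal_l (h ^ k) (c k)), Series_correct, Hc. }
  induction K as [|K IH].
  - rewrite sum_O. apply is_series_ext with (2 := G 0%nat).
    intros n. now rewrite sum_O.
  - rewrite sum_n_S.
    apply is_series_ext with (2 := is_series_plus _ _ _ _ IH (G (S K))).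
    intros n. now rewrite sum_n_S.
Qed.

(** The series of Taylor expansions of the pairs is summed in the other order.
Half of [x0] serves as radius so that the dominating series keeps the decay
exponent [x0 - rho > 0]. *)
Lemma eta_part_analytic (phi y x0 : R) : 0 < x0 ->
  real_analytic_at (fun x => eta_part phi x y) x0.
Proof.
  intros Hx0. set (rho := x0 / 2).
  assert (Hrho : 0 < rho < x0) by (unfold rho; lra).
  set (c := fun k n => taylor_coef x0 y phi (ln_odd n) k
                       - taylor_coef x0 y phi (ln_even n) k).
  set (V := fun n => (x0 + Rabs y + rho)
    * ((ln_even n - ln_odd n) * exp (- ((x0 - rho) * ln_odd n)))).
  assert (HV : ex_series V).
  { apply ex_series_Rmult, ex_series_gap. lra. }
  assert (HcV : forall K n, sum_n (fun k => rho ^ k * Rabs (c k n)) K <= V n).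
  { intros K n. apply taylor_coef_diff_bound; [|lra].
    split; [apply ln_odd_ge_0 | apply ln_odd_even]. }
  assert (Hc1 : forall k n, rho ^ k * Rabs (c k n) <= V n).
  { intros k n. apply Rle_trans with (2 := HcV k n).
    assert (P : forall j, 0 <= rho ^ j * Rabs (c j n)).
    { intros j. apply Rmult_le_pos; [apply pow_le; lra | apply Rabs_pos]. }
    destruct k as [|k]; [rewrite sum_O; apply Rle_refl|].
    rewrite sum_n_S.
    assert (Q : 0 <= sum_n (fun k0 => rho ^ k0 * Rabs (c k0 n)) k).
    { clear - P. induction k as [|k IH]; [rewrite sum_O; apply P|].
      rewrite sum_n_S. specialize (P (S k)). lra. }
    lra. }
  assert (Hc : forall k, ex_series (c k)).
  { intros k. apply (@ex_series_le R_AbsRing R_CompleteNormedModule) with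
      (fun n => / rho ^ k * V n).
    - intros n. unfold norm; simpl; unfold abs; simpl.
      assert (Hp : 0 < rho ^ k) by (apply pow_lt; lra).
      apply (Rmult_le_reg_l (rho ^ k)); [exact Hp|].
      rewrite <- Rmult_assoc, Rinv_r, Rmult_1_l by lra. apply Hc1.
    - now apply ex_series_Rmult. }
  exists (fun k => Series (c k)), rho. split; [lra|].
  intros x Hx. set (h := x - x0) in *.
  destruct (is_lim_seq_dominated (fun K n => sum_n (fun k => h ^ k * c k n) K)
              V (pair_term x y phi)) as [_ L].
  - exact HV.
  - intros K n. apply Rle_trans with (2 := HcV K n).
    clear - Hx. induction K as [|K IH].
    + rewrite !sum_O, Rabs_mult. simpl. rewrite Rabs_R1. lra.
    + rewrite !sum_n_S.
      eapply Rle_trans; [apply Rabs_triang|].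
      apply Rplus_le_compat; [exact IH|].
      rewrite Rabs_mult, <- RPow_abs. apply Rmult_le_compat_r; [apply Rabs_pos|].
      apply pow_incr. split; [apply Rabs_pos | lra].
  - intros n. unfold pair_term. replace x with (x0 + h) by (unfold h; ring).
    assert (D := is_series_minus _ _ _ _
      (taylor_osc x0 y phi (ln_odd n) h) (taylor_osc x0 y phi (ln_even n) h)).
    apply is_lim_seq_ext with (2 := D). intros K. apply sum_n_ext. intros k.
    unfold c, plus, opp; simpl. ring.
  - unfold is_pseries, is_series.
    change (is_lim_seq (sum_n (fun k => scal (pow_n h k) (Series (c k))))
              (eta_part phi x y)).
    apply is_lim_seq_ext with (2 := L). intros K.
    rewrite (is_series_unique _ _ (sum_n_Series c h K Hc)).
    apply sum_n_ext. intros k. symmetry. apply scal_pow_n.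
Qed.

(** * Limits of complex sequences *)

Definition is_Clim (u : nat -> C) (l : C) : Prop :=
  is_lim_seq (fun n => Re (u n)) (Re l) /\ is_lim_seq (fun n => Im (u n)) (Im l).

Lemma is_Clim_unique (u : nat -> C) (l m : C) :
  is_Clim u l -> is_Clim u m -> l = m.
Proof.
  intros [H1 H2] [H3 H4].
  apply is_lim_seq_unique in H1. apply is_lim_seq_unique in H2.
  apply is_lim_seq_unique in H3. apply is_lim_seq_unique in H4.
  rewrite H1 in H3. rewrite H2 in H4. injection H3. injection H4.
  destruct l, m. simpl. intros -> ->. reflexivity.
Qed.

Lemma is_Clim_ext (u v : nat -> C) (l : C) :
  (forall n, u n = v n) -> is_Clim u l -> is_Clim v l.
Proof.
  intros E [H1 H2].
  split; [apply is_lim_seq_ext with (2 := H1) | apply is_lim_seq_ext with (2 := H2)];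
    intros n; now rewrite E.
Qed.

Lemma is_Clim_const (c : C) : is_Clim (fun _ => c) c.
Proof. split; apply is_lim_seq_const. Qed.

Lemma is_Clim_plus (u v : nat -> C) (l m : C) :
  is_Clim u l -> is_Clim v m -> is_Clim (fun n => u n + v n)%C (l + m)%C.
Proof. intros [H1 H2] [H3 H4]. split; now apply is_lim_seq_plus'. Qed.

Lemma is_Clim_opp (u : nat -> C) (l : C) :
  is_Clim u l -> is_Clim (fun n => - u n)%C (- l)%C.
Proof.
  intros [H1 H2]. split;
    [apply (is_lim_seq_opp _ (Re l)) | apply (is_lim_seq_opp _ (Im l))]; assumption.
Qed.

Lemma is_Clim_mult (u v : nat -> C) (l m : C) :
  is_Clim u l -> is_Clim v m -> is_Clim (fun n => u n * v n)%C (l * m)%C.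
Proof.
  intros [H1 H2] [H3 H4]. split.
  - apply is_lim_seq_minus'; now apply is_lim_seq_mult'.
  - apply is_lim_seq_plus'; now apply is_lim_seq_mult'.
Qed.

Lemma is_Clim_minus (u v : nat -> C) (l m : C) :
  is_Clim u l -> is_Clim v m -> is_Clim (fun n => u n - v n)%C (l - m)%C.
Proof. intros Hu Hv. apply is_Clim_plus; [|apply is_Clim_opp]; assumption. Qed.

Lemma is_lim_seq_strict (u : nat -> R) (l : Rbar) (f : nat -> nat) :
  (forall n, (n <= f n)%nat) -> is_lim_seq u l -> is_lim_seq (fun n => u (f n)) l.
Proof.
  intros Hf. apply is_lim_seq_subseq.
  intros P [N HN]. exists N. intros n Hn. apply HN. specialize (Hf n). lia.
Qed.

Lemma is_Clim_subseq (u : nat -> C) (l : C) (f : nat -> nat) :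
  (forall n, (n <= f n)%nat) -> is_Clim u l -> is_Clim (fun n => u (f n)) l.
Proof.
  intros Hf [H1 H2].
  split; [apply (is_lim_seq_strict _ _ f Hf H1) | apply (is_lim_seq_strict _ _ f Hf H2)].
Qed.

(** The even indices start at [2] because sums of [N + 1] pairs end at [2 N + 2]. *)
Lemma is_lim_seq_parity (u : nat -> R) (l : R) :
  is_lim_seq (fun n => u (2 * n + 2)%nat) l ->
  is_lim_seq (fun n => u (2 * n + 1)%nat) l ->
  is_lim_seq u l.
Proof.
  intros H0 H1. apply is_lim_seq_spec. intros eps.
  apply is_lim_seq_spec in H0. apply is_lim_seq_spec in H1.
  destruct (H0 eps) as [N0 HN0]. destruct (H1 eps) as [N1 HN1].
  exists (2 * (N0 + N1) + 2)%nat. intros n Hn.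
  destruct (Nat.Even_or_Odd n) as [[m ->]|[m ->]].
  - replace (2 * m)%nat with (2 * (m - 1) + 2)%nat by lia. apply HN0. lia.
  - apply HN1. lia.
Qed.

Lemma Cmod_le_Re_Im (z : C) : Cmod z <= Rabs (Re z) + Rabs (Im z).
Proof.
  replace z with (RtoC (Re z) + Ci * RtoC (Im z))%C at 1.
  - eapply Rle_trans; [apply Cmod_triangle|].
    rewrite Cmod_mult, !Cmod_R.
    replace (Cmod Ci) with 1; [lra|].
    transitivity (sqrt 1); [now rewrite sqrt_1|].
    unfold Cmod, Ci. simpl. f_equal. ring.
  - destruct z as [x y]. unfold Ci, RtoC, Cplus, Cmult. simpl. f_equal; ring.
Qed.

Lemma is_Clim_Cmod (u : nat -> C) (l : C) (eps : R) : is_Clim u l -> 0 < eps ->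
  exists N, forall n, (N <= n)%nat -> Cmod (u n - l) < eps.
Proof.
  intros [H1 H2] He. assert (He2 : 0 < eps / 2) by lra.
  apply is_lim_seq_spec in H1. apply is_lim_seq_spec in H2.
  destruct (H1 (mkposreal _ He2)) as [N1 HN1].
  destruct (H2 (mkposreal _ He2)) as [N2 HN2].
  exists (N1 + N2)%nat. intros n Hn.
  specialize (HN1 n ltac:(lia)). specialize (HN2 n ltac:(lia)). simpl in *.
  eapply Rle_lt_trans; [apply Cmod_le_Re_Im|].
  unfold Rminus in *. unfold Re, Im in *. simpl. lra.
Qed.

Lemma Re_sum_n (u : nat -> C) (N : nat) :
  Re (sum_n u N) = sum_n (fun n => Re (u n)) N.
Proof.
  induction N as [|N IH]; [now rewrite !sum_O|].
  rewrite sum_Sn, sum_n_S, <- IH. reflexivity.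
Qed.

Lemma Im_sum_n (u : nat -> C) (N : nat) :
  Im (sum_n u N) = sum_n (fun n => Im (u n)) N.
Proof.
  induction N as [|N IH]; [now rewrite !sum_O|].
  rewrite sum_Sn, sum_n_S, <- IH. reflexivity.
Qed.

Lemma is_series_Clim (u : nat -> C) (l : C) :
  is_series (K := C_AbsRing) (V := C_NormedModule) u l -> is_Clim (sum_n u) l.
Proof.
  intros H. split.
  - refine (filterlim_comp _ _ _ (sum_n u) Re eventually _ _ H _).
    destruct l as [x y]. apply (continuous_fst x y).
  - refine (filterlim_comp _ _ _ (sum_n u) Im eventually _ _ H _).
    destruct l as [x y]. apply (continuous_snd x y).
Qed.

(** On the line [p + t d] the complex power series becomes a power series in the
real variable [t], with coefficients [d^k a_k]; taking real and imaginary parts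
is then termwise. *)
Lemma analytic_at_line (f : C -> C) (p d : C) (t0 : R) : d <> 0%C ->
  analytic_at f (p + RtoC t0 * d)%C ->
  real_analytic_at (fun t => Re (f (p + RtoC t * d)%C)) t0 /\
  real_analytic_at (fun t => Im (f (p + RtoC t * d)%C)) t0.
Proof.
  intros Hd (a & r & Hr & Ha).
  assert (Hd0 : 0 < Cmod d) by now apply Cmod_gt_0.
  assert (Hrd : 0 < r / Cmod d) by now apply Rdiv_lt_0_compat.
  assert (HS : forall t, Rabs (t - t0) < r / Cmod d ->
    is_Clim (sum_n (fun k => RtoC ((t - t0) ^ k) * (pow_n (K := C_Ring) d k * a k))%C)
            (f (p + RtoC t * d)%C)).
  { intros t Ht.
    assert (E : (p + RtoC t * d - (p + RtoC t0 * d))%C = (RtoC (t - t0) * d)%C).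
    { rewrite RtoC_minus. ring. }
    specialize (Ha (p + RtoC t * d)%C). rewrite E in Ha.
    apply is_series_Clim. apply is_series_ext with (2 := Ha ltac:(
      rewrite Cmod_mult, Cmod_R;
      apply (Rmult_lt_compat_r (Cmod d)) in Ht; [|exact Hd0];
      unfold Rdiv in Ht; rewrite Rmult_assoc, Rinv_l in Ht; lra)).
    intros k. change (pow_n (K := C_Ring) (RtoC (t - t0) * d)%C k * a k
      = RtoC ((t - t0) ^ k) * (pow_n (K := C_Ring) d k * a k))%C.
    rewrite Cmult_assoc. f_equal. clear. induction k as [|k IH].
    - simpl. change one with (RtoC 1). ring.
    - simpl. rewrite IH, RtoC_mult. unfold mult; simpl. ring. }
  split.
  - exists (fun k => Re (pow_n (K := C_Ring) d k * a k)%C), (r / Cmod d).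
    split; [exact Hrd|]. intros t Ht. destruct (HS t Ht) as [H _].
    apply (is_lim_seq_ext _ _ (Re (f (p + RtoC t * d)%C))) with (2 := H).
    intros n. rewrite Re_sum_n. apply sum_n_ext. intros k.
    rewrite scal_pow_n. unfold Cmult, Re, Im. simpl. ring.
  - exists (fun k => Im (pow_n (K := C_Ring) d k * a k)%C), (r / Cmod d).
    split; [exact Hrd|]. intros t Ht. destruct (HS t Ht) as [_ H].
    apply (is_lim_seq_ext _ _ (Im (f (p + RtoC t * d)%C))) with (2 := H).
    intros n. rewrite Im_sum_n. apply sum_n_ext. intros k.
    rewrite scal_pow_n. unfold Cmult, Re, Im. simpl. ring.
Qed.

(** * Complex powers *)

Lemma Cexp_plus (z w : C) : Cexp (z + w) = (Cexp z * Cexp w)%C.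
Proof.
  destruct z as [x y], w as [u v]. unfold Cexp, Cplus, Cmult. simpl.
  rewrite exp_plus, cos_plus, sin_plus. f_equal; ring.
Qed.

Lemma Cexp_0 : Cexp 0 = 1%C.
Proof. unfold Cexp. simpl. rewrite exp_0, cos_0, sin_0. unfold RtoC. f_equal; ring. Qed.

Lemma Cexp_neq_0 (z : C) : Cexp z <> 0%C.
Proof.
  intros H. apply C1_nz. rewrite <- Cexp_0.
  replace (RtoC 0) with (z + - z)%C by ring. rewrite Cexp_plus, H. ring.
Qed.

Lemma Cinv_Cexp (z : C) : (/ Cexp z)%C = Cexp (- z).
Proof.
  rewrite <- (Cmult_1_r (/ Cexp z)), <- Cexp_0.
  replace (RtoC 0) with (z + - z)%C by ring. rewrite Cexp_plus, Cmult_assoc.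
  rewrite Cinv_l by apply Cexp_neq_0. ring.
Qed.

Lemma Rcpow_neq_0 (a : R) (s : C) : Rcpow a s <> 0%C.
Proof. apply Cexp_neq_0. Qed.

Lemma Rcpow_mult_base (a b : R) (s : C) : 0 < a -> 0 < b ->
  Rcpow (a * b) s = (Rcpow a s * Rcpow b s)%C.
Proof.
  intros Ha Hb. unfold Rcpow. rewrite ln_mult, RtoC_plus by assumption.
  rewrite <- Cexp_plus. f_equal. ring.
Qed.

Lemma Rcpow_plus (a : R) (s t : C) : Rcpow a (s + t) = (Rcpow a s * Rcpow a t)%C.
Proof. unfold Rcpow. rewrite <- Cexp_plus. f_equal. ring. Qed.

Lemma Rcpow_1 (a : R) : 0 < a -> Rcpow a 1 = RtoC a.
Proof.
  intros Ha. unfold Rcpow. rewrite Cmult_1_l. unfold Cexp. simpl.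
  rewrite exp_ln, cos_0, sin_0 by exact Ha. unfold RtoC. f_equal; ring.
Qed.

Lemma Rcpow_2_1_minus (s : C) : Rcpow 2 (1 - s) = (2 * / Rcpow 2 s)%C.
Proof.
  rewrite <- (Rcpow_1 2) by lra. unfold Rcpow. rewrite Cinv_Cexp, <- Cexp_plus.
  f_equal. ring.
Qed.

Lemma Cinv_Rcpow (a : R) (s : C) :
  (/ Rcpow a s)%C = (osc (Re s) (Im s) 0 (ln a), osc (Re s) (Im s) (PI / 2) (ln a)).
Proof.
  unfold Rcpow. rewrite Cinv_Cexp. destruct s as [x y].
  unfold Cexp, osc, RtoC, Cmult, Copp. simpl.
  rewrite Rplus_0_r, cos_plus, cos_PI2, sin_PI2.
  replace (- (x * 0 + y * ln a)) with (- (y * ln a)) by ring.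
  replace (- (x * ln a - y * 0)) with (- (x * ln a)) by ring.
  rewrite cos_neg, sin_neg. f_equal. ring.
Qed.

(** * The alternating series and the zeta function *)

Definition eta (s : C) : C :=
  (eta_part 0 (Re s) (Im s), eta_part (PI / 2) (Re s) (Im s)).

Definition dirichlet_sum (s : C) (N : nat) : C :=
  sum_n_m (fun n => / Rcpow (INR n) s)%C 1 N.

Definition alternating_sum (s : C) (N : nat) : C :=
  sum_n_m (fun n => RtoC (-1) ^ n / Rcpow (INR n) s)%C 1 N.

Lemma sum_n_m_1_S (u : nat -> C) (N : nat) :
  sum_n_m u 1 (S N) = (sum_n_m u 1 N + u (S N))%C.
Proof. exact (sum_n_Sm u 1 N (le_n_S _ _ (Nat.le_0_l N))). Qed.

Lemma sum_n_m_1_0 (u : nat -> C) : sum_n_m u 1 0 = RtoC 0.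
Proof. exact (sum_n_m_zero u 1 0 Nat.lt_0_1). Qed.

Lemma Cpow_m1_even (n : nat) : (RtoC (-1) ^ (2 * n))%C = 1%C.
Proof. rewrite <- RtoC_pow, pow_1_even. reflexivity. Qed.

Lemma alternating_sum_S2 (s : C) (n : nat) :
  alternating_sum s (2 * n + 2) = (alternating_sum s (2 * n)
    - (/ Rcpow (INR (2 * n + 1)) s - / Rcpow (INR (2 * n + 2)) s))%C.
Proof.
  unfold alternating_sum.
  replace (2 * n + 2)%nat with (S (S (2 * n))) by lia.
  rewrite !sum_n_m_1_S.
  replace (2 * n + 1)%nat with (S (2 * n)) by lia.
  rewrite !Cpow_S, Cpow_m1_even. unfold Cdiv.
  replace (RtoC (-1)) with (- RtoC 1)%C by (rewrite <- RtoC_opp; f_equal; lra).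
  ring.
Qed.

Lemma dirichlet_sum_S2 (s : C) (n : nat) :
  dirichlet_sum s (2 * n + 2) = (dirichlet_sum s (2 * n)
    + / Rcpow (INR (2 * n + 1)) s + / Rcpow (INR (2 * n + 2)) s)%C.
Proof.
  unfold dirichlet_sum.
  replace (2 * n + 2)%nat with (S (S (2 * n))) by lia.
  rewrite !sum_n_m_1_S.
  replace (2 * n + 1)%nat with (S (2 * n)) by lia. reflexivity.
Qed.

(** Among the first [2N] terms, the even-indexed ones are [2^(-s)] times the first
[N] terms; an alternating sum is twice the even part minus everything. *)
Lemma alternating_sum_even (s : C) (N : nat) :
  alternating_sum s (2 * N)
  = (Rcpow 2 (1 - s) * dirichlet_sum s N - dirichlet_sum s (2 * N))%C.
Proof.
  induction N as [|N IH].
  - unfold alternating_sum, dirichlet_sum. simpl. rewrite !sum_n_m_1_0. ring.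
  - replace (2 * S N)%nat with (2 * N + 2)%nat by lia.
    rewrite alternating_sum_S2, dirichlet_sum_S2, IH.
    unfold dirichlet_sum at 3. rewrite sum_n_m_1_S. fold (dirichlet_sum s N).
    rewrite Rcpow_2_1_minus.
    replace (INR (2 * N + 2)) with (2 * INR (S N))
      by (rewrite S_INR, plus_INR, mult_INR; simpl; ring).
    rewrite Rcpow_mult_base by (try lra; apply lt_0_INR; lia).
    field. repeat split; apply Rcpow_neq_0.
Qed.

Lemma alternating_sum_even_lim (s : C) : 0 < Re s ->
  is_Clim (fun N => alternating_sum s (2 * N + 2)) (- eta s)%C.
Proof.
  intros Hs.
  assert (E : forall N, (- sum_n (fun n => / Rcpow (INR (2 * n + 1)) s
                     - / Rcpow (INR (2 * n + 2)) s) N)%C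
                    = alternating_sum s (2 * N + 2)).
  { induction N as [|N IH].
    - rewrite sum_O, alternating_sum_S2. unfold alternating_sum. simpl (2 * 0)%nat.
      rewrite sum_n_m_1_0. ring.
    - rewrite sum_Sn, alternating_sum_S2.
      replace (2 * S N)%nat with (2 * N + 2)%nat by lia.
      rewrite <- IH. unfold plus; simpl. ring. }
  apply is_Clim_ext with (1 := E). apply is_Clim_opp. split.
  - apply is_lim_seq_ext with (2 := is_series_eta_part 0 (Re s) (Im s) Hs).
    intros N. rewrite Re_sum_n. apply sum_n_ext. intros n.
    now rewrite !Cinv_Rcpow.
  - apply is_lim_seq_ext with (2 := is_series_eta_part (PI / 2) (Re s) (Im s) Hs).
    intros N. rewrite Im_sum_n. apply sum_n_ext. intros n.
    now rewrite !Cinv_Rcpow.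
Qed.

Lemma osc_lim_0 (x y phi : R) : 0 < x ->
  is_lim_seq (fun n => osc x y phi (ln (INR n))) 0.
Proof.
  intros Hx. apply is_lim_seq_abs_0.
  apply (is_lim_seq_le_le (fun _ => 0) _ (fun n => exp (- (x * ln (INR n)))) 0).
  - intros n. split; [apply Rabs_pos | apply osc_bound].
  - apply is_lim_seq_const.
  - assert (L : is_lim_seq (fun n => ln (INR n)) p_infty).
    { apply (is_lim_comp_seq ln INR p_infty p_infty).
      - apply is_lim_ln_p.
      - now exists 0%nat.
      - apply is_lim_seq_INR. }
    apply (is_lim_comp_seq exp (fun n => - (x * ln (INR n))) m_infty 0).
    + apply is_lim_exp_m.
    + now exists 0%nat.
    + apply (is_lim_seq_opp _ p_infty).
      replace p_infty with (Rbar_mult x p_infty).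
      * now apply is_lim_seq_scal_l.
      * simpl. destruct (Rle_dec 0 x) as [H|H]; [|lra].
        destruct (Rle_lt_or_eq_dec 0 x H); [reflexivity | lra].
Qed.

(** The paired series only controls partial sums of even length; the odd ones
differ from those by a term that tends to [0]. *)
Lemma alternating_sum_lim (s : C) : 0 < Re s ->
  is_Clim (alternating_sum s) (- eta s)%C.
Proof.
  intros Hs. assert (Heven := alternating_sum_even_lim s Hs).
  assert (H0 : is_Clim (fun N => / Rcpow (INR N) s)%C 0%C).
  { split.
    - apply is_lim_seq_ext with (2 := osc_lim_0 (Re s) (Im s) 0 Hs).
      intros n. now rewrite Cinv_Rcpow.
    - apply is_lim_seq_ext with (2 := osc_lim_0 (Re s) (Im s) (PI / 2) Hs).
      intros n. now rewrite Cinv_Rcpow. }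
  assert (Hodd : is_Clim (fun N => alternating_sum s (2 * N + 1)) (- eta s)%C).
  { replace (- eta s)%C with (- eta s - 0)%C by ring.
    apply is_Clim_ext with (fun N => alternating_sum s (2 * N + 2)
                                     - / Rcpow (INR (2 * N + 2)) s)%C.
    - intros N. unfold alternating_sum.
      replace (2 * N + 2)%nat with (S (2 * N + 1)) by lia.
      rewrite sum_n_m_1_S. replace (S (2 * N + 1)) with (2 * (N + 1))%nat at 1 by lia.
      rewrite Cpow_m1_even. unfold Cdiv. ring.
    - apply is_Clim_minus; [exact Heven|].
      apply (is_Clim_subseq (fun N => / Rcpow (INR N) s)%C); [intros; lia | exact H0]. }
  destruct Heven, Hodd.
  split; apply is_lim_seq_parity; assumption.
Qed.

Lemma dirichlet_sum_lim (zeta : C -> C) (s : C) :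
  is_riemann_zeta zeta -> 1 < Re s -> is_Clim (dirichlet_sum s) (zeta s).
Proof.
  intros [Hz _] Hs. specialize (Hz s Hs). apply is_series_Clim in Hz.
  assert (G : is_Clim (fun N => dirichlet_sum s (S N)) (zeta s)).
  { apply is_Clim_ext with (2 := Hz). intros N. unfold dirichlet_sum.
    rewrite <- sum_n_m_S. apply sum_n_m_ext. intros n. apply Cmult_1_l. }
  destruct G. split; now apply is_lim_seq_incr_1.
Qed.

Lemma eta_zeta_right (zeta : C -> C) (s : C) : is_riemann_zeta zeta -> 1 < Re s ->
  eta s = ((1 - Rcpow 2 (1 - s)) * zeta s)%C.
Proof.
  intros Hz Hs. assert (HL := dirichlet_sum_lim zeta s Hz Hs).
  assert (H1 : is_Clim (fun N => alternating_sum s (2 * N)) (- eta s)%C).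
  { apply (is_Clim_subseq (alternating_sum s)); [intros; lia|].
    apply alternating_sum_lim. lra. }
  assert (H2 : is_Clim (fun N => alternating_sum s (2 * N))
                 (Rcpow 2 (1 - s) * zeta s - zeta s)%C).
  { apply is_Clim_ext with (1 := fun N => eq_sym (alternating_sum_even s N)).
    apply is_Clim_minus.
    - apply is_Clim_mult; [apply is_Clim_const | exact HL].
    - apply (is_Clim_subseq (dirichlet_sum s)); [intros; lia | exact HL]. }
  assert (E := is_Clim_unique _ _ _ H1 H2).
  replace (eta s) with (- - eta s)%C by ring. rewrite E. ring.
Qed.

Lemma Rcpow_2_1_minus_pair (x y : R) : Rcpow 2 (1 - (x, y))
  = (exp (ln 2 - x * ln 2) * cos (y * ln 2), exp (ln 2 - x * ln 2) * - sin (y * ln 2)).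
Proof.
  unfold Rcpow, Cexp, RtoC, Cminus, Cplus, Copp, Cmult. simpl.
  replace ((1 + - x) * ln 2 - (0 + - y) * 0) with (ln 2 - x * ln 2) by ring.
  replace ((1 + - x) * 0 + (0 + - y) * ln 2) with (- (y * ln 2)) by ring.
  now rewrite cos_neg, sin_neg.
Qed.

Lemma real_analytic_opp (f : R -> R) (x0 : R) :
  real_analytic_at f x0 -> real_analytic_at (fun x => - f x) x0.
Proof.
  intros H. apply real_analytic_ext with (fun x => -1 * f x).
  - intros x. ring.
  - apply real_analytic_mult; [apply real_analytic_const | exact H].
Qed.

(** Continuation along the horizontal line through [(x, y)], from [Re > 1]. *)
Lemma eta_zeta_nonreal (zeta : C -> C) (x y : R) : is_riemann_zeta zeta ->
  0 < x -> y <> 0 ->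
  eta (x, y) = ((1 - Rcpow 2 (1 - (x, y))) * zeta (x, y))%C.
Proof.
  intros Hz Hx Hy.
  assert (Ez : forall t, ((0, y) + RtoC t * 1)%C = (t, y)).
  { intros t. unfold RtoC, Cplus, Cmult. simpl. f_equal; ring. }
  assert (Hza : forall t, real_analytic_at (fun t => Re (zeta (t, y))) t /\
                          real_analytic_at (fun t => Im (zeta (t, y))) t).
  { intros t. destruct (analytic_at_line zeta (0, y) 1 t) as [H1 H2].
    - apply C1_nz.
    - apply Hz. rewrite Ez. intros E. apply Hy. now injection E.
    - split;
        [apply real_analytic_ext with (2 := H1) | apply real_analytic_ext with (2 := H2)];
        intros u; now rewrite Ez. }
  assert (Hexp : forall c t0, real_analytic_at (fun t => exp (ln 2 - t * ln 2) * c) t0).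
  { intros c t0. apply real_analytic_mult;
      [apply real_analytic_exp | apply real_analytic_const]. }
  set (D := fun t => (eta (t, y) - (1 - Rcpow 2 (1 - (t, y))) * zeta (t, y))%C).
  assert (HD : forall t, 1 < t -> D t = 0%C).
  { intros t Ht. unfold D. rewrite (eta_zeta_right zeta (t, y)) by assumption. ring. }
  assert (HRe : Re (D x) = 0).
  { apply (real_analytic_identity (fun t => Re (D t)) 0 1); [| |exact Hx].
    - intros t Ht. destruct (Hza t) as [H1 H2].
      apply real_analytic_ext with (fun t => eta_part 0 t y
        + (- ((1 + - (exp (ln 2 - t * ln 2) * cos (y * ln 2))) * Re (zeta (t, y)))
           + exp (ln 2 - t * ln 2) * sin (y * ln 2) * Im (zeta (t, y)))).
      + intros u. unfold D. rewrite Rcpow_2_1_minus_pair.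
        unfold eta, Re, Im. simpl. ring.
      + apply real_analytic_plus; [now apply eta_part_analytic|].
        apply real_analytic_plus.
        * apply real_analytic_opp, real_analytic_mult; [|assumption].
          apply real_analytic_plus;
            [apply real_analytic_const | apply real_analytic_opp, Hexp].
        * apply real_analytic_mult; [apply Hexp | assumption].
    - intros t Ht. now rewrite HD. }
  assert (HIm : Im (D x) = 0).
  { apply (real_analytic_identity (fun t => Im (D t)) 0 1); [| |exact Hx].
    - intros t Ht. destruct (Hza t) as [H1 H2].
      apply real_analytic_ext with (fun t => eta_part (PI / 2) t y
        + (- ((1 + - (exp (ln 2 - t * ln 2) * cos (y * ln 2))) * Im (zeta (t, y)))
           + - (exp (ln 2 - t * ln 2) * sin (y * ln 2) * Re (zeta (t, y))))).
      + intros u. unfold D. rewrite Rcpow_2_1_minus_pair.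
        unfold eta, Re, Im. simpl. ring.
      + apply real_analytic_plus; [now apply eta_part_analytic|].
        apply real_analytic_plus.
        * apply real_analytic_opp, real_analytic_mult; [|assumption].
          apply real_analytic_plus;
            [apply real_analytic_const | apply real_analytic_opp, Hexp].
        * apply real_analytic_opp. apply real_analytic_mult; [apply Hexp | assumption].
    - intros t Ht. now rewrite HD. }
  assert (E : D x = 0%C).
  { rewrite (surjective_pairing (D x)). unfold Re, Im in *. now rewrite HRe, HIm. }
  unfold D in E. set (w := ((1 - _) * _)%C) in *.
  replace (eta (x, y)) with (eta (x, y) - w + w)%C by ring. rewrite E. ring.
Qed.

(** The horizontal line through a real point may meet the pole, so the point is
approached vertically, through points covered by the non-real case. *)
Lemma eta_zeta_real (zeta : C -> C) (x : R) : is_riemann_zeta zeta ->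
  0 < x -> x <> 1 ->
  eta (x, 0) = ((1 - Rcpow 2 (1 - (x, 0))) * zeta (x, 0))%C.
Proof.
  intros Hz Hx Hx1. set (u := fun k => / (INR k + 1)).
  assert (Hu0 : forall k, 0 < u k).
  { intros k. apply Rinv_0_lt_compat. generalize (pos_INR k). lra. }
  assert (Hu1 : forall k, Rabs (u k) <= 1).
  { intros k. rewrite Rabs_pos_eq by (left; apply Hu0).
    unfold u. rewrite <- Rinv_1. apply Rinv_le_contravar; [lra|].
    generalize (pos_INR k). lra. }
  assert (Hu : is_lim_seq u 0).
  { replace (Finite 0) with (Rbar_inv p_infty) by reflexivity.
    apply is_lim_seq_inv; [|discriminate].
    eapply is_lim_seq_plus;
      [apply is_lim_seq_INR | apply is_lim_seq_const | reflexivity]. }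
  assert (H1 : is_Clim (fun k => eta (x, u k)) (eta (x, 0))).
  { split; now apply (eta_part_continuous _ x 0 1). }
  assert (Ez : forall t, (RtoC x + RtoC t * Ci)%C = (x, t)).
  { intros t. unfold RtoC, Cplus, Cmult, Ci. simpl. f_equal; ring. }
  assert (H2 : is_Clim (fun k => zeta (x, u k)) (zeta (x, 0))).
  { destruct (analytic_at_line zeta (RtoC x) Ci 0) as [G1 G2].
    - intros E. injection E. lra.
    - apply Hz. rewrite Ez. intros E. apply Hx1. now injection E.
    - apply real_analytic_continuous in G1. apply real_analytic_continuous in G2.
      rewrite <- (Ez 0).
      split; [apply is_lim_seq_ext with (fun k => Re (zeta (RtoC x + RtoC (u k) * Ci)%C))
             |apply is_lim_seq_ext with (fun k => Im (zeta (RtoC x + RtoC (u k) * Ci)%C))].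
      + intros k. now rewrite Ez.
      + exact (filterlim_comp _ _ _ u _ eventually _ _ Hu G1).
      + intros k. now rewrite Ez.
      + exact (filterlim_comp _ _ _ u _ eventually _ _ Hu G2). }
  assert (Hul : is_lim_seq (fun k => u k * ln 2) (0 * ln 2))
    by now apply (is_lim_seq_scal_r u (ln 2) 0).
  assert (H3 : is_Clim (fun k => Rcpow 2 (1 - (x, u k))) (Rcpow 2 (1 - (x, 0)))).
  { rewrite Rcpow_2_1_minus_pair.
    apply is_Clim_ext with (1 := fun k => eq_sym (Rcpow_2_1_minus_pair x (u k))).
    split.
    - apply (is_lim_seq_scal_l _ _ (cos (0 * ln 2))).
      apply (is_lim_seq_continuous cos); [apply continuity_cos | exact Hul].
    - apply (is_lim_seq_scal_l _ _ (- sin (0 * ln 2))).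
      apply (is_lim_seq_opp _ (sin (0 * ln 2))).
      apply (is_lim_seq_continuous sin); [apply continuity_sin | exact Hul]. }
  apply is_Clim_unique with (1 := H1).
  apply is_Clim_ext with (fun k => (1 - Rcpow 2 (1 - (x, u k))) * zeta (x, u k))%C.
  - intros k. symmetry. apply eta_zeta_nonreal; [exact Hz | exact Hx |].
    specialize (Hu0 k). lra.
  - apply is_Clim_mult; [|exact H2].
    apply is_Clim_minus; [apply is_Clim_const | exact H3].
Qed.

Lemma harmonic_minus_ln_cv :
  exists g : R, is_lim_seq (fun n => sum_n (fun k => / INR (S k)) n - ln (INR (S n))) g.
Proof.
  assert (Hl : forall n, / INR (S (S n)) <= ln (INR (S (S n))) - ln (INR (S n))
                         <= / INR (S n)).
  { intros n.
    assert (P1 : 0 < INR (S n)) by (apply lt_0_INR; lia).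
    assert (P2 : INR (S (S n)) = INR (S n) + 1) by apply S_INR.
    rewrite P2. set (t := INR (S n)) in *. split.
    - assert (H : ln (t / (t + 1)) <= t / (t + 1) - 1).
      { generalize (exp_ineq1_le (ln (t / (t + 1)))).
        rewrite exp_ln by (apply Rdiv_lt_0_compat; lra). lra. }
      rewrite ln_div in H by lra.
      replace (t / (t + 1) - 1) with (- / (t + 1)) in H by (field; lra). lra.
    - assert (H : ln ((t + 1) / t) <= (t + 1) / t - 1).
      { generalize (exp_ineq1_le (ln ((t + 1) / t))).
        rewrite exp_ln by (apply Rdiv_lt_0_compat; lra). lra. }
      rewrite ln_div in H by lra.
      replace ((t + 1) / t - 1) with (/ t) in H by (field; lra). lra. }
  apply (ex_finite_lim_seq_decr _ 0).
  - intros n. rewrite sum_n_S. specialize (Hl n). lra.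
  - intros n. enough (ln (INR (S (S n))) <= sum_n (fun k => / INR (S k)) n).
    { specialize (Hl n). assert (0 < / INR (S (S n)))
        by (apply Rinv_0_lt_compat, lt_0_INR; lia). lra. }
    induction n as [|n IH].
    + rewrite sum_O. specialize (Hl 0%nat). change (INR 1) with 1 in *.
      rewrite ln_1 in Hl. lra.
    + rewrite sum_n_S. specialize (Hl (S n)). lra.
Qed.

Lemma dirichlet_sum_1 (N : nat) :
  dirichlet_sum 1 (S N) = RtoC (sum_n (fun k => / INR (S k)) N).
Proof.
  assert (T : forall n, (/ Rcpow (INR (S n)) 1)%C = RtoC (/ INR (S n))).
  { intros n. rewrite Rcpow_1 by (apply lt_0_INR; lia).
    rewrite RtoC_inv by (apply not_0_INR; lia). reflexivity. }
  unfold dirichlet_sum. induction N as [|N IH].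
  - rewrite sum_n_n, sum_O. apply T.
  - rewrite sum_n_m_1_S, IH, T, sum_n_S, RtoC_plus. reflexivity.
Qed.

(** At [s = 1] the alternating sum of length [2N] is [H_N - H_(2N)], which is
[v_N - v_(2N) - ln 2] for [v_n = H_n - ln n]; the limit of [v] cancels.  In the
proof [v] is indexed from [0], so [v N] stands for [v_(N+1)]. *)
Lemma eta_1 : eta 1 = RtoC (ln 2).
Proof.
  destruct harmonic_minus_ln_cv as [g Hg].
  set (v := fun n => sum_n (fun k => / INR (S k)) n - ln (INR (S n))) in Hg.
  assert (H1 : is_Clim (fun N => alternating_sum 1 (2 * S N)) (- eta 1)%C).
  { apply (is_Clim_subseq (alternating_sum 1)); [intros; lia|].
    apply alternating_sum_lim. simpl. lra. }
  assert (H2 : is_Clim (fun N => alternating_sum 1 (2 * S N)) (- RtoC (ln 2))%C).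
  { apply is_Clim_ext with (fun N => RtoC (v N - v (2 * N + 1)%nat - ln 2)).
    - intros N. rewrite alternating_sum_even.
      replace (2 * S N)%nat with (S (2 * N + 1)) by lia.
      rewrite !dirichlet_sum_1, Rcpow_2_1_minus, Rcpow_1 by lra.
      rewrite Cinv_r by (intros E; injection E; lra).
      rewrite Cmult_1_l, <- RtoC_minus. f_equal. unfold v.
      replace (INR (S (2 * N + 1))) with (2 * INR (S N))
        by (rewrite !S_INR, plus_INR, mult_INR; simpl; ring).
      rewrite ln_mult by (try lra; apply lt_0_INR; lia). ring.
    - split; [|apply is_lim_seq_ext with (fun _ => 0);
                [reflexivity | simpl; rewrite Ropp_0; apply is_lim_seq_const]].
      simpl. replace (- ln 2) with (g - g - ln 2) by ring.
      apply is_lim_seq_minus'; [|apply is_lim_seq_const].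
      apply is_lim_seq_minus'; [exact Hg|].
      apply (is_lim_seq_strict v); [intros; lia | exact Hg]. }
  assert (E := is_Clim_unique _ _ _ H1 H2).
  replace (eta 1) with (- - eta 1)%C by ring. rewrite E. ring.
Qed.

Lemma eta_alt_zeta (zeta : C -> C) (s : C) : is_riemann_zeta zeta -> 0 < Re s ->
  eta s = alt_zeta zeta s.
Proof.
  intros Hz Hs. unfold alt_zeta. destruct (Ceq_dec s 1) as [->|Hs1].
  - apply eta_1.
  - destruct s as [x y]. destruct (Req_dec y 0) as [->|Hy].
    + apply eta_zeta_real; [exact Hz | exact Hs |]. intros ->. now apply Hs1.
    + now apply eta_zeta_nonreal.
Qed.

(** * Off-diagonal double sums *)

Lemma off_diagonal_row (c d : nat -> C) (i q : nat) : (1 <= i)%nat ->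
  sum_n_m (fun j => if Nat.eqb i j then RtoC 0 else c i * d j)%C 1 q
  = (c i * sum_n_m d 1 q - (if Nat.leb i q then c i * d i else 0))%C :> C.
Proof.
  intros Hi. induction q as [|q IH].
  - rewrite !sum_n_m_1_0. destruct (Nat.leb_spec i 0); [lia | ring].
  - rewrite !sum_n_m_1_S, IH.
    destruct (Nat.eqb_spec i (S q)) as [->|Hne].
    + rewrite Nat.leb_refl, (proj2 (Nat.leb_gt (S q) q)) by lia. ring.
    + destruct (Nat.leb_spec i q), (Nat.leb_spec i (S q)); try lia; ring.
Qed.

Lemma off_diagonal_sum (c d : nat -> C) (p q : nat) :
  sum_n_m (fun i => sum_n_m (fun j => if Nat.eqb i j then RtoC 0 else c i * d j)%C 1 q) 1 p
  = (sum_n_m c 1 p * sum_n_m d 1 q - sum_n_m (fun i => c i * d i)%C 1 (Nat.min p q))%C :> C.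
Proof.
  induction p as [|p IH].
  - simpl. rewrite !sum_n_m_1_0. ring.
  - rewrite !sum_n_m_1_S, IH, off_diagonal_row by lia.
    destruct (Nat.leb_spec (S p) q) as [H|H].
    + rewrite (Nat.min_l (S p)), (Nat.min_l p) by lia. rewrite sum_n_m_1_S. ring.
    + rewrite (Nat.min_r (S p)), (Nat.min_r p) by lia. ring.
Qed.

(** [off_diagonal_sum] turns the double limit into three single ones, because
[min p q] is large as soon as [p] and [q] both are. *)
Lemma pringsheim_off_diagonal (c d : nat -> C) (A B E : C) :
  is_Clim (sum_n_m c 1) A -> is_Clim (sum_n_m d 1) B ->
  is_Clim (sum_n_m (fun i => c i * d i)%C 1) E ->
  is_pringsheim_sum (fun i j => if Nat.eqb i j then RtoC 0 else c i * d j)%C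
    (A * B - E)%C.
Proof.
  intros HA HB HE eps Heps.
  assert (Hmod := Rplus_le_le_0_compat _ _ (Cmod_ge_0 A) (Cmod_ge_0 B)).
  set (M := 1 + Cmod A + Cmod B).
  set (delta := Rmin 1 (eps / 2 / M)).
  assert (HM : 0 < M) by (unfold M; lra).
  assert (Hdelta : 0 < delta).
  { apply Rmin_glb_lt; [lra|]. apply Rdiv_lt_0_compat; lra. }
  assert (Hd1 : delta <= 1) by apply Rmin_l.
  assert (HdM : delta * M <= eps / 2).
  { apply Rle_trans with (eps / 2 / M * M).
    - apply Rmult_le_compat_r; [lra | apply Rmin_r].
    - right. field. lra. }
  destruct (is_Clim_Cmod _ _ delta HA Hdelta) as [N1 HN1].
  destruct (is_Clim_Cmod _ _ delta HB Hdelta) as [N2 HN2].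
  destruct (is_Clim_Cmod _ _ (eps / 2) HE ltac:(lra)) as [N3 HN3].
  exists (N1 + N2 + N3)%nat. intros p q Hp Hq.
  specialize (HN1 p ltac:(lia)). specialize (HN2 q ltac:(lia)).
  specialize (HN3 (Nat.min p q) ltac:(lia)).
  rewrite off_diagonal_sum.
  set (a := sum_n_m c 1 p) in *. set (b := sum_n_m d 1 q) in *.
  set (e := sum_n_m _ 1 (Nat.min p q)) in *.
  replace (a * b - e - (A * B - E))%C
    with ((a - A) * (b - B) + (A * (b - B) + B * (a - A)) + - (e - E))%C by ring.
  eapply Rle_lt_trans; [apply Cmod_triangle|]. rewrite Cmod_opp.
  assert (T1 := Cmod_triangle ((a - A) * (b - B)) (A * (b - B) + B * (a - A))).
  assert (T2 := Cmod_triangle (A * (b - B)) (B * (a - A))).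
  rewrite !Cmod_mult in *.
  assert (Cmod (a - A) * Cmod (b - B) <= delta * 1)
    by (apply Rmult_le_compat; try apply Cmod_ge_0; lra).
  assert (Cmod A * Cmod (b - B) <= Cmod A * delta)
    by (apply Rmult_le_compat_l; [apply Cmod_ge_0 | lra]).
  assert (Cmod B * Cmod (a - A) <= Cmod B * delta)
    by (apply Rmult_le_compat_l; [apply Cmod_ge_0 | lra]).
  unfold M in HdM. lra.
Qed.

Open Scope C_scope.

Theorem lemma2 (zeta : C -> C) (hzeta : is_riemann_zeta zeta)
    (s : C) (hs : (1 / 2 < Re s)%R) :
  is_pringsheim_sum
    (fun n1 n2 : nat =>
       if Nat.eqb n1 n2 then RtoC 0
       else RtoC (-1) ^ (n1 + n2)
            / (Rcpow (INR n1) s * Rcpow (INR n2) (Cconj s)))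
    (alt_zeta zeta s * alt_zeta zeta (Cconj s) - zeta (RtoC (2 * Re s))).
Proof.
  assert (hs' : (1 / 2 < Re (Cconj s))%R) by exact hs.
  rewrite <- !eta_alt_zeta by (assumption || lra).
  set (c := fun n => RtoC (-1) ^ n / Rcpow (INR n) s).
  set (d := fun n => RtoC (-1) ^ n / Rcpow (INR n) (Cconj s)).
  assert (Hdiag : forall n, / Rcpow (INR n) (RtoC (2 * Re s)) = c n * d n).
  { intros n. unfold c, d. replace (RtoC (2 * Re s)) with (s + Cconj s).
    2: { destruct s as [x y]. unfold Cconj, RtoC, Cplus. simpl. f_equal; ring. }
    rewrite Rcpow_plus, <- (Cmult_1_l (/ _)), <- (Cpow_m1_even n).
    replace (2 * n)%nat with (n + n)%nat by lia. rewrite Cpow_add_r.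
    field. repeat split; apply Rcpow_neq_0. }
  assert (Hoff : forall i j, c i * d j = RtoC (-1) ^ (i + j)
                   / (Rcpow (INR i) s * Rcpow (INR j) (Cconj s))).
  { intros i j. unfold c, d. rewrite Cpow_add_r.
    field. repeat split; apply Rcpow_neq_0. }
  assert (P : is_pringsheim_sum
                (fun i j => if Nat.eqb i j then RtoC 0 else c i * d j)
                (- eta s * - eta (Cconj s) - zeta (RtoC (2 * Re s)))).
  { apply pringsheim_off_diagonal.
    - apply alternating_sum_lim. lra.
    - apply alternating_sum_lim. lra.
    - apply is_Clim_ext with (dirichlet_sum (RtoC (2 * Re s))).
      + intros N. now apply sum_n_m_ext.
      + apply dirichlet_sum_lim; [exact hzeta|]. unfold Re at 1. simpl. lra. }
  replace (eta s * eta (Cconj s)) with (- eta s * - eta (Cconj s)) by ring.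
  intros eps Heps. destruct (P eps Heps) as [nu Hnu]. exists nu. intros p q Hp Hq.
  erewrite sum_n_m_ext; [exact (Hnu p q Hp Hq)|].
  intros i. apply sum_n_m_ext. intros j.
  destruct (Nat.eqb i j); [reflexivity | symmetry; apply Hoff].
Qed.
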